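(* Let $\{Y_{i,n}\}_{1\le i\le n,\ n\ge 1}$ be a triangular array of real-valued random variables (no independence is assumed). Let $\mu_n=\frac1n\sum_{i=1}^n\delta_{Y_{i,n}}$ be the empirical measure of the $n$-th row and let $\bar\mu_n=\mathbb{E}[\mu_n]$. Assume there exists a sequence of real numbers $r_n\ge 2$ with $r_n\to\infty$ such that: (a) (Uniform tail control) there exists $\zeta>0$, not depending on $n$, such that $\sup_{1\le i\le n}\|Y_{i,n}\|_{\Psi_{r_n}}\le\zeta$ for every $n$; (b) (Moment concentration) for every fixed integer $k\ge1$, $$\operatorname{Var}\Bigl(\frac1n\sum_{i=1}^nY_{i,n}^k\Bigr)\to0\quad\text{as } n\to\infty.$$ Then $$\mathbb{E}\bigl[W_1(\mu_n,\bar\mu_n)\bigr]\to0\quad\text{as } n\to\infty.$$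
   Context: For each $n$, the variables $Y_{1,n},\dots,Y_{n,n}$ are defined on a common probability space. The expected measure $\bar\mu_n=\mathbb{E}[\mu_n]$ is the deterministic probability measure on $\mathbb{R}$ given by $\bar\mu_n(A)=\mathbb{E}[\mu_n(A)]$ for Borel sets $A$. The 1-Wasserstein distance between two probability measures $\mu,\nu$ on $\mathbb{R}$ is defined by the dual form $W_1(\mu,\nu)=\sup_{f\in\operatorname{Lip}(1)}\left|\int f\,d\mu-\int f\,d\nu\right|$, where $\operatorname{Lip}(1)$ is the set of $1$-Lipschitz functions $f:\mathbb{R}\to\mathbb{R}$. For a real number $r\ge2$, let $\Psi_r(x)=\sum_{j=1}^{\lfloor r/2\rfloor}\frac{x^{2j}}{j!}$. The $\Psi_r$ norm of a random variable $X$ is $\|X\|_{\Psi_r}=\inf\{K>0:\mathbb{E}[\Psi_r(|X|/K)]\le1\}$. Condition (b) is asymptotic in $n$: for each fixed $k$ it only concerns all sufficiently large $n$. *)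

(* Defs.v *)
From HB Require Import structures.
From mathcomp Require Import all_boot all_order all_algebra.
From mathcomp Require Import all_classical all_reals all_analysis.
From mathcomp Require Import measurable_realfun.

Set Implicit Arguments.
Unset Strict Implicit.
Unset Printing Implicit Defensive.

Import Order.TTheory GRing.Theory Num.Theory.
Import numFieldNormedType.Exports.

Local Open Scope classical_set_scope.
Local Open Scope ring_scope.

Section empirical_measure.
Local Open Scope ereal_scope.
Context {R : realType} (n : nat) (y : 'I_n -> R).

(* The zero measure when n = 0. *)
Definition empirical (A : set R) : \bar R :=
  (n%:R^-1)%:E * \sum_(i < n) \d_(y i) A.

Let empirical0 : empirical set0 = 0.
Proof. by rewrite /empirical big1 ?mule0// => i _; rewrite measure0. Qed.

Let empirical_ge0 A : 0 <= empirical A.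
Proof.
by apply: mule_ge0; [rewrite lee_fin invr_ge0|apply: sume_ge0].
Qed.

Let empirical_sigma_additive : semi_sigma_additive empirical.
Proof.
move=> F mF tF mUF.
have -> : (fun k => \sum_(0 <= j < k) empirical (F j)) =
  (fun k => (n%:R^-1)%:E * \sum_(i < n) \sum_(0 <= j < k) \d_(y i) (F j)).
  apply/funext => k; rewrite exchange_big/= ge0_sume_distrr//.
  by move=> j _; apply: sume_ge0.
apply: cvgeZl => //; apply: cvg_nnesum => [i _|i _].
  by apply: nearW => k; apply: sume_ge0.
exact: measure_semi_sigma_additive.
Qed.

HB.instance Definition _ := isMeasure.Build _ _ _ empirical
  empirical0 empirical_ge0 empirical_sigma_additive.

Lemma empirical_setT : (0 < n)%N -> empirical setT = 1.
Proof.
move=> n0; rewrite /empirical (eq_bigr (fun=> 1)); last first.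
  by move=> i _; rewrite diracT.
rewrite sumEFin sumr_const card_ord -EFinM mulVf//.
by rewrite pnatr_eq0 -lt0n.
Qed.

End empirical_measure.

Section mean_empirical_measure.
Local Open Scope ereal_scope.
Context {R : realType} d (T : measurableType d) (P : probability T R).
Context (n : nat) (Y : 'I_n -> {RV P >-> R}).

Definition empirical_RV (w : T) : {measure set R -> \bar R} :=
  empirical (fun i => Y i w).

Definition mean_empirical (A : set R) : \bar R :=
  \int[P]_w empirical_RV w A.

Lemma measurable_empirical_RV (A : set R) : measurable A ->
  measurable_fun setT (fun w => empirical_RV w A).
Proof.
move=> mA; apply: emeasurable_funM => //.
apply: emeasurable_sum => i.
rewrite (_ : (fun w => _) = (fun w => (\1_A (Y i w))%:E)) //.
apply/measurable_EFinP.
have mI : measurable_fun setT (\1_A : R -> R) by exact: measurable_indic.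
exact: (measurableT_comp mI (measurable_funPT (Y i))).
Qed.

Let mean_empirical0 : mean_empirical set0 = 0.
Proof.
by rewrite /mean_empirical; under eq_integral do rewrite measure0;
  rewrite integral0.
Qed.

Let mean_empirical_ge0 A : 0 <= mean_empirical A.
Proof. by apply: integral_ge0 => w _; exact: measure_ge0. Qed.

Let mean_empirical_sigma_additive : semi_sigma_additive mean_empirical.
Proof.
move=> F mF tF mUF.
rewrite [X in _ --> X](_ : _ = \sum_(j <oo) mean_empirical (F j)).
  by apply: is_cvg_ereal_nneg_natsum => j _; exact: mean_empirical_ge0.
rewrite /mean_empirical -integral_nneseries//.
- apply: eq_integral => w _.
  by rewrite measure_semi_bigcup.
- by move=> j; exact: measurable_empirical_RV.
Qed.

HB.instance Definition _ := isMeasure.Build _ _ _ mean_empirical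
  mean_empirical0 mean_empirical_ge0 mean_empirical_sigma_additive.

Lemma mean_empirical_setT : (0 < n)%N -> mean_empirical setT = 1.
Proof.
move=> n0; rewrite /mean_empirical.
under eq_integral do rewrite [empirical_RV _ _]empirical_setT//.
by rewrite integral_cst// mul1e; exact: probability_setT.
Qed.

End mean_empirical_measure.

Definition wasserstein1 {R : realType} (mu nu : {measure set R -> \bar R}) :
    \bar R :=
  ereal_sup [set `|\int[mu]_x (f x)%:E - \int[nu]_x (f x)%:E|%E |
             f in [set f : R -> R | 1.-lipschitz f]].

Definition Psi {R : realType} (r x : R) : R :=
  \sum_(1 <= j < (Num.truncn (r / 2)).+1) x ^+ (2 * j) / j`!%:R.

(* Extended-real valued: the infimum is +oo when no K is admissible. *)
Definition Psi_norm {R : realType} d (T : measurableType d)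
    (P : probability T R) (r : R) (X : T -> R) : \bar R :=
  ereal_inf [set K%:E | K in
    [set K : R | 0 < K /\ ('E_P[fun w => Psi r (`|X w| / K)] <= 1)%E]].

(* Main.v *)
(** Call a function h concentrating if E|mu_n(h) - E mu_n(h)| -> 0. Monomials
    concentrate by (b). The bound E Y^(2j) <= j! K^(2j) coming from (a) makes
    the Taylor remainder of cos (a x + phi) of order 2j small in mean,
    uniformly in n, since (aK)^(2j) j! / (2j)! -> 0; it only involves finitely
    many moments, which exist for n large. Hence all trigonometric polynomials
    concentrate. The Bernstein basis of degree m evaluated at
    (1 + sin (x / L)) / 2 is a partition of unity of R by finitely many
    trigonometric polynomials psi_j, which on [-L, L] concentrates around nodes
    x_j in [-L, L]. For 1-Lipschitz f with f 0 = 0, replacing f by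
    sum_j f(x_j) psi_j costs at most eps + 2 x^2 / L at x, and
    |f(x_j)| <= L, so W_1(mu_n, E mu_n) is at most 2 eps + (2 / L)(second
    moments) + L sum_j |mu_n(psi_j) - E mu_n(psi_j)|, uniformly in f. *)

Require Import Defs.
From mathcomp Require Import all_boot all_order all_algebra.
From mathcomp Require Import all_classical all_reals all_analysis.
From mathcomp Require Import measurable_realfun.
From mathcomp Require Import ring lra.

Set Implicit Arguments.
Unset Strict Implicit.
Unset Printing Implicit Defensive.

Import Order.TTheory GRing.Theory Num.Theory.
Import numFieldNormedType.Exports.

Local Open Scope classical_set_scope.
Local Open Scope ring_scope.

(** * Taylor polynomials of the cosine *)

Section cos_taylor.
Context {R : realType}.
Implicit Types (x phi : R) (f g : R -> R) (m : nat).

(** Mean value theorem for [g - f] on [[0, x]]; it replaces integration in the Taylor estimate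
    below. *)
Lemma le_increment_derive f (df : R -> R) g (dg : R -> R) x : 0 <= x ->
  (forall t : R, is_derive t 1 f (df t)) ->
  (forall t : R, is_derive t 1 g (dg t)) ->
  (forall t, 0 <= t -> df t <= dg t) -> f x - f 0 <= g x - g 0.
Proof.
move=> x0 fdf gdg dfg.
have hd (t : R) : is_derive t 1 (g - f) (dg t - df t) by exact: is_deriveB.
have [|c] := @MVT_segment R (g - f) (fun t => dg t - df t) 0 x x0 (fun t _ => hd t).
  apply: continuous_subspaceT => t.
  by apply/differentiable_continuous/derivable1_diffP; have [] := hd t.
rewrite in_itv/= => /andP[c0 _] /eqP; rewrite !fctE subr0 => /eqP h.
have : 0 <= (dg c - df c) * x by rewrite mulr_ge0// subr_ge0 dfg.
rewrite -h; lra.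
Qed.

Lemma is_derive_divpower m x :
  is_derive x 1 (fun t => t ^+ m.+1 / m.+1`!%:R) (x ^+ m / m`!%:R).
Proof.
have -> : (fun t : R => t ^+ m.+1 / m.+1`!%:R) = (m.+1`!%:R^-1) \*: (id ^+ m.+1).
  by apply/funext => t; rewrite /= /GRing.scale/= !fctE mulrC.
have h := is_deriveZ m.+1`!%:R^-1 (is_deriveX m.+1 (is_derive_id x 1)).
apply: (is_derive_eq h); rewrite /GRing.scale/= mulr1 factS natrM.
have : m`!%:R != 0 :> R by rewrite pnatr_eq0 -lt0n fact_gt0.
have : m.+1%:R != 0 :> R by rewrite pnatr_eq0.
by move=> ? ?; field; apply/andP.
Qed.

Lemma is_derive_taylor_sum (c : nat -> R) m x :
  is_derive x 1 (fun t => \sum_(j < m.+1) c j * (t ^+ j / j`!%:R))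
    (\sum_(j < m) c j.+1 * (x ^+ j / j`!%:R)).
Proof.
elim: m => [|m ih].
  rewrite big_ord0 (_ : (fun t => _) = cst (c 0 * (1 / 0`!%:R))).
    exact: is_derive_cst.
  by apply/funext => t; rewrite big_ord1 expr0.
rewrite big_ord_recr/=.
rewrite (_ : (fun t => _) = (fun t => \sum_(j < m.+1) c j * (t ^+ j / j`!%:R))
   + c m.+1 \*: (fun t => t ^+ m.+1 / m.+1`!%:R)); last first.
  by apply/funext => t; rewrite big_ord_recr.
apply: is_deriveD; apply: is_deriveZ; exact: is_derive_divpower.
Qed.

(** Writing [- sin] as a cosine with phase [phi + pi / 2] keeps the family of shifted cosines closed
    under differentiation. *)
Lemma is_derive_cosD phi x :
  is_derive x 1 (fun t => cos (t + phi)) (cos (x + (phi + pi / 2))).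
Proof.
rewrite addrA cosDpihalf.
have hD : is_derive x 1 (id + cst phi : R -> R) (1 + 0) by exact: is_deriveD.
have hc := is_derive_cos ((id + cst phi : R -> R) x).
have := @is_derive1_comp R (@cos R) (id + cst phi) x _ _ hc hD.
by rewrite addr0 mulr1 !fctE.
Qed.

(** Induction on [m] with the phase free: the derivative of the remainder of order [m + 1] at phase
    [phi] is the remainder of order [m] at phase [phi + pi / 2], and [x^m / m!] is the derivative of
    [x^(m+1) / (m+1)!]. *)
Lemma cos_taylor_ge0 m phi x : 0 <= x ->
  `|cos (x + phi) - \sum_(j < m) cos (phi + j%:R * (pi / 2)) * (x ^+ j / j`!%:R)|
    <= x ^+ m / m`!%:R.
Proof.
elim: m phi x => [|m ih] phi x x0.
  by rewrite big_ord0 subr0 expr0 fact0 divr1 cos_max.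
pose g : R -> R := fun t => cos (t + phi) -
  \sum_(j < m.+1) cos (phi + j%:R * (pi / 2)) * (t ^+ j / j`!%:R).
pose dg t := cos (t + (phi + pi / 2)) -
  \sum_(j < m) cos (phi + pi / 2 + j%:R * (pi / 2)) * (t ^+ j / j`!%:R).
have gdg (t : R) : is_derive t 1 g (dg t).
  rewrite /dg (eq_bigr (fun j : 'I_m =>
     cos (phi + j.+1%:R * (pi / 2)) * (t ^+ j / j`!%:R))); last first.
    by move=> j _; congr (cos _ * _); rewrite -natr1; ring.
  apply: is_deriveB; first exact: is_derive_cosD.
  exact: (is_derive_taylor_sum (fun j => cos (phi + j%:R * (pi / 2)))).
have g0 : g 0 = 0.
  rewrite /g big_ord_recl/= big1 ?addr0 => [|j _]; last first.
    by rewrite /bump/= add1n expr0n/= mul0r mulr0.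
  by rewrite mul0r addr0 add0r expr0 fact0 divr1 mulr1 subrr.
have h0 : 0 ^+ m.+1 / m.+1`!%:R = 0 :> R by rewrite expr0n/= mul0r.
have gN (t : R) : is_derive t 1 (fun s => - g s) (- dg t) by exact: is_deriveN.
(* Since [g] and the majorant both vanish at 0, comparing derivatives for [- g] and for [g] gives
   the two sides of the bound. *)
rewrite -/(g x) ler_norml; apply/andP; split.
  have := @le_increment_derive (fun s => - g s) (fun t => - dg t) _ _ x x0 gN
    (is_derive_divpower m) _.
  rewrite g0 h0 subr0 oppr0 subr0 lerNl; apply => t t0.
  by have /ler_normlP[] := ih (phi + pi / 2) t t0.
have := @le_increment_derive g dg _ _ x x0 gdg (is_derive_divpower m) _.
rewrite g0 h0 !subr0; apply => t t0.
by have /ler_normlP[] := ih (phi + pi / 2) t t0.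
Qed.

(** A negative [x] is handled by evenness of the cosine, passing to [- x] and phase [- phi]. *)
Lemma cos_taylor m phi x :
  `|cos (x + phi) - \sum_(j < m) cos (phi + j%:R * (pi / 2)) * (x ^+ j / j`!%:R)|
    <= `|x| ^+ m / m`!%:R.
Proof.
have [x0|/ltW x0] := leP 0 x; first by rewrite (ger0_norm x0) cos_taylor_ge0.
have Nx0 : 0 <= - x by rewrite oppr_ge0.
rewrite (ler0_norm x0); apply: le_trans (cos_taylor_ge0 m (- phi) Nx0).
(* The sign [(-1)^j] of [(- x)^j] shifts the phase by [j pi], which turns [phi - j pi / 2] into
   [phi + j pi / 2]. *)
rewrite -opprD cosN; under [in leRHS]eq_bigr => j _.
  rewrite -(cosN (_ + _)) opprD opprK exprNn.
  rewrite (_ : _ * (_ / _) = ((-1) ^+ j * cos (phi - j%:R * (pi / 2))) *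
    (x ^+ j / j`!%:R)); last by ring.
  rewrite -(alternatingn (@cosDpi R)) -mulr_natr.
  rewrite (_ : phi - _ + _ = phi + j%:R * (pi / 2)); last by field.
  over.
by [].
Qed.

End cos_taylor.

(** * A partition of unity by trigonometric polynomials *)

Section bernstein.
Context {R : realType}.
Implicit Types (u c : R) (m j : nat).

(* The Bernstein basis 'C(m, j) u^j (1 - u)^(m - j), by Pascal's rule. *)
Fixpoint bernstein u m j : R :=
  match m, j with
  | 0, 0 => 1
  | 0, _.+1 => 0
  | m'.+1, 0 => (1 - u) * bernstein u m' 0
  | m'.+1, j'.+1 => (1 - u) * bernstein u m' j'.+1 + u * bernstein u m' j'
  end.

Lemma bernstein_ge0 u m j : 0 <= u <= 1 -> 0 <= bernstein u m j.
Proof.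
move=> /andP[u0 u1]; have u1' : 0 <= 1 - u by rewrite subr_ge0.
by elim: m j => [|m ih] [|j] //=; rewrite ?addr_ge0// mulr_ge0.
Qed.

Lemma bernstein_small u m j : (m < j)%N -> bernstein u m j = 0.
Proof.
elim: m j => [|m ih] [|j]//= mj; rewrite !ih//; first by rewrite !mulr0 addr0.
exact: ltnW.
Qed.

(** Conditioning on one of [m + 1] Bernoulli trials; the moments of the binomial law then follow by
    induction on [m]. *)
Lemma sum_bernsteinS (F : nat -> R) u m :
  \sum_(j < m.+2) F j * bernstein u m.+1 j =
  \sum_(j < m.+1) ((1 - u) * F j + u * F j.+1) * bernstein u m j.
Proof.
rewrite big_ord_recl/=.
under eq_bigr => j _ do rewrite /bump/= add1n mulrDr.
rewrite big_split/= addrA.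
have -> : F 0 * ((1 - u) * bernstein u m 0) +
    \sum_(i < m.+1) F i.+1 * ((1 - u) * bernstein u m i.+1) =
    \sum_(i < m.+2) F i * ((1 - u) * bernstein u m i).
  by rewrite [RHS]big_ord_recl.
rewrite big_ord_recr/= bernstein_small// !mulr0 addr0 -big_split/=.
by apply: eq_bigr => j _; ring.
Qed.

Lemma sum_bernstein u m : \sum_(j < m.+1) bernstein u m j = 1.
Proof.
elim: m => [|m ih]; first by rewrite big_ord1.
have := sum_bernsteinS (fun=> 1) u m.
under eq_bigr do rewrite mul1r; move=> ->.
rewrite -[RHS]ih; apply: eq_bigr => j _; ring.
Qed.

(** Second moment of the binomial law about [c]: variance plus squared bias. The centre is arbitrary
    because the induction moves it to [c - 1]. *)
Lemma sum_sqr_bernstein u c m :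
  \sum_(j < m.+1) (j%:R - c) ^+ 2 * bernstein u m j =
  m%:R * u * (1 - u) + (m%:R * u - c) ^+ 2.
Proof.
elim: m c => [|m ih] c; first by rewrite big_ord1/=; ring.
rewrite (sum_bernsteinS (fun j => (j%:R - c) ^+ 2)).
transitivity ((1 - u) * \sum_(j < m.+1) (j%:R - c) ^+ 2 * bernstein u m j +
  u * \sum_(j < m.+1) (j%:R - (c - 1)) ^+ 2 * bernstein u m j).
  rewrite 2!mulr_sumr -big_split/=; apply: eq_bigr => j _.
  by rewrite -natr1; ring.
by rewrite !ih -natr1; ring.
Qed.

(* AM-GM in the form |z| <= eps + z^2 / eps, with z = u - j / m *)
Lemma sum_dist_bernstein u m (eps : R) : 0 < eps -> (0 < m)%N -> 0 <= u <= 1 ->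
  \sum_(j < m.+1) `|u - j%:R / m%:R| * bernstein u m j <=
  eps + (m%:R * eps)^-1.
Proof.
move=> e0 m0 /[dup] u01 /andP[u0 u1].
have m0' : 0 < m%:R :> R by rewrite ltr0n.
apply: (@le_trans _ _ (\sum_(j < m.+1)
   (eps + (m%:R ^+ 2 * eps)^-1 * (j%:R - m%:R * u) ^+ 2) * bernstein u m j)).
  apply: ler_sum => j _; rewrite ler_wpM2r ?bernstein_ge0//.
  set z := `|_|.
  have -> : (m%:R ^+ 2 * eps)^-1 * (j%:R - m%:R * u) ^+ 2 = z ^+ 2 / eps.
    by rewrite /z real_normK ?num_real//; field; rewrite !gt_eqF.
  rewrite -(ler_pM2r e0) mulrDl divfK ?gt_eqF//.
  by have := sqr_ge0 (z - eps); have := sqr_ge0 z; nra.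
under eq_bigr do rewrite mulrDl -mulrA.
rewrite big_split/= -!mulr_sumr sum_bernstein mulr1 lerD2l.
(* Centring at [m u] leaves only the variance, and [u (1 - u) <= 1]. *)
rewrite sum_sqr_bernstein subrr expr0n/= addr0.
rewrite (_ : _ * _ = (m%:R * eps)^-1 * (u * (1 - u))); last first.
  by field; rewrite !gt_eqF.
by rewrite ler_piMr ?invr_ge0 ?mulr_ge0 ?(ltW m0') ?(ltW e0)//; nra.
Qed.

End bernstein.

(** * Transport of the Bernstein basis to the line by the sine *)

Section sine_nodes.
Context {R : realType}.
Implicit Types (s t v x L : R) (m j : nat).

(** Mean value theorem, with the cosine bounded below by [cos 1] on [[-1, 1]] because it is even and
    decreasing on [[0, pi]]. *)
Lemma sin_expand s t : -1 <= s <= 1 -> -1 <= t <= 1 ->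
  cos 1 * `|s - t| <= `|sin s - sin t|.
Proof.
wlog st : s t / s <= t.
  move=> wlg s1 t1; have [/wlg|/ltW/wlg h] := leP s t; first exact.
  by rewrite distrC [leRHS]distrC h.
move=> /andP[s1 _] /andP[_ t1].
have [|c] := @MVT_segment R (@sin R) (@cos R) s t st (fun x _ => is_derive_sin x).
  by apply: continuous_subspaceT => x; exact: continuous_sin.
rewrite in_itv/= => /andP[sc ct] h.
have c1 : `|c| <= 1 by rewrite ler_norml (le_trans s1)//= (le_trans ct).
have cos1c : cos 1 <= cos c.
  have pi1 : 1 <= pi :> R by rewrite (le_trans _ (pi_ge2 R))// ler1n.
  have c0pi : `|c| \in `[0, pi] by rewrite in_itv/= normr_ge0/= (le_trans c1).
  have o0pi : (1 : R) \in `[0, pi] by rewrite in_itv/= ler01.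
  by rewrite -(cos_norm c) leNgt ltr_cos// -leNgt.
rewrite distrC [leRHS]distrC h normrM ler_wpM2r//.
by rewrite (le_trans cos1c)// ler_norm.
Qed.

(** The argument is clamped to the image of [[-1, 1]] under [sin], so that the value avoids the ends
    of [[-pi / 2, pi / 2]], near which the inverse of the sine is not Lipschitz. *)
Definition arcsin_clamp v : R :=
  asin (Num.max (- sin 1) (Num.min (sin 1) v)).

Let sin1_ge0 : 0 <= sin 1 :> R.
Proof. by rewrite sin_ge0_pi// ler01/= (le_trans _ (pi_ge2 R))// ler1n. Qed.

Let mem_pihalf s : -1 <= s <= 1 -> s \in `[(- (pi / 2)), (pi / 2)].
Proof.
have := @pihalf_ge1 R => p1 /andP[s1 s2].
by rewrite in_itv/=; apply/andP; split; lra.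
Qed.

Lemma arcsin_clampE v :
  sin (arcsin_clamp v) = Num.max (- sin 1) (Num.min (sin 1) v).
Proof.
rewrite asinK// in_itv/= le_max lerN2 sin_le1/= ge_max ge_min sin_le1 orTb andbT.
by have := sin1_ge0; lra.
Qed.

(** The sine is increasing on [[-pi / 2, pi / 2]], so the comparisons with -1 and 1 can be made
    after applying it. *)
Lemma arcsin_clamp_itv v : -1 <= arcsin_clamp v <= 1.
Proof.
have s1 := sin1_ge0.
have hv : -1 <= Num.max (- sin 1) (Num.min (sin 1) v) <= 1.
  rewrite le_max lerN2 sin_le1/= ge_max ge_min sin_le1 orTb andbT.
  by lra.
have [w1 w2] := (asin_geNpi2 hv, asin_lepi2 hv).
rewrite -/(arcsin_clamp v) in w1 w2.
have wi : arcsin_clamp v \in `[(- (pi / 2)), (pi / 2)] by rewrite in_itv/= w1 w2.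
have oi : (1 : R) \in `[(- (pi / 2)), (pi / 2)] by apply: mem_pihalf; lra.
have Noi : (- 1 : R) \in `[(- (pi / 2)), (pi / 2)] by apply: mem_pihalf; lra.
apply/andP; split; rewrite leNgt -ltr_sin// arcsin_clampE -leNgt.
  by rewrite sinN le_max lexx.
by rewrite ge_max ge_min lexx/= andbT; lra.
Qed.

(* Clamping to [-sin 1, sin 1] fixes sin s and is 1-Lipschitz. *)
Lemma arcsin_clamp_dist s v : -1 <= s <= 1 ->
  cos 1 * `|s - arcsin_clamp v| <= `|sin s - v|.
Proof.
move=> /[dup] s1 /andP[s11 s12].
apply: (le_trans (sin_expand s1 (arcsin_clamp_itv v))).
have si := mem_pihalf s1.
have oi : (1 : R) \in `[(- (pi / 2)), (pi / 2)] by apply: mem_pihalf; lra.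
have Noi : (- 1 : R) \in `[(- (pi / 2)), (pi / 2)] by apply: mem_pihalf; lra.
have h1 : sin s <= sin 1 by rewrite leNgt ltr_sin// -leNgt.
have h2 : - sin 1 <= sin s by rewrite -sinN leNgt ltr_sin// -leNgt.
have /ler_normlP[h5 h6] := lexx `|sin s - v|.
rewrite arcsin_clampE; have [v1|v1] := leP (sin 1) v.
  by rewrite max_r; [rewrite ler_norml; apply/andP; split; lra|have := sin1_ge0; lra].
by have [v2|v2] := leP (- sin 1) v; rewrite ?lexx// ler_norml; apply/andP; split; lra.
Qed.

Definition sine01 L x := (1 + sin (x / L)) / 2.

Lemma sine01_itv L x : 0 <= sine01 L x <= 1.
Proof.
have := sin_le1 (x / L); have := sin_geN1 (x / L); rewrite /sine01 => ? ?.
by apply/andP; split; lra.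
Qed.

(** Up to the clamp, the point of [[-L, L]] at which [sine01 L] takes the value [j / m]. *)
Definition sine_node L m j := L * arcsin_clamp (2 * (j%:R / m%:R) - 1).

Lemma sine_node_le L m j : 0 <= L -> `|sine_node L m j| <= L.
Proof.
move=> L0; rewrite normrM (ger0_norm L0) ler_piMr// ler_norml.
exact: arcsin_clamp_itv.
Qed.

Lemma sine_node_dist L m j x : 0 < L -> `|x| <= L ->
  `|x - sine_node L m j| <= 2 * L / cos 1 * `|sine01 L x - j%:R / m%:R|.
Proof.
move=> L0 xL; have c1 := @cos1_gt0 R.
have xL1 : -1 <= x / L <= 1.
  by rewrite -ler_norml normrM normfV (gtr0_norm L0) ler_pdivrMr// mul1r.
have := arcsin_clamp_dist (2 * (j%:R / m%:R) - 1) xL1.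
rewrite (_ : sin _ - _ = 2 * (sine01 L x - j%:R / m%:R)); last first.
  by rewrite /sine01; move: (_ / m%:R) (sin _) => p q; lra.
rewrite normrM ger0_norm// mulrC -ler_pdivlMr// => h.
rewrite (_ : x - _ = L * (x / L - arcsin_clamp (2 * (j%:R / m%:R) - 1))); last first.
  by rewrite /sine_node; move: (arcsin_clamp _) => q; field; rewrite gt_eqF.
rewrite normrM (gtr0_norm L0) (_ : 2 * L / cos 1 * _ = L *
  (2 * `|sine01 L x - j%:R / m%:R| / cos 1)); last first.
  by move: `|_| => q; field; rewrite gt_eqF.
by rewrite ler_wpM2l// ltW.
Qed.

Definition sine_bump L m j x := bernstein (sine01 L x) m j.

Lemma sine_bump_ge0 L m j x : 0 <= sine_bump L m j x.
Proof. exact/bernstein_ge0/sine01_itv. Qed.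

Lemma sum_sine_bump L m x : \sum_(j < m.+1) sine_bump L m j x = 1.
Proof. exact: sum_bernstein. Qed.

(** The degree is uniform in [x]. For [|x| <= L] the Bernstein bound gives [eps]; for [|x| > L] the
    crude bound [|x - x_j| <= 2 |x|] is absorbed by the quadratic term. *)
Lemma sine_bump_concentration L (eps : R) : 0 < L -> 0 < eps ->
  exists m, forall x, \sum_(j < m.+1) `|x - sine_node L m j| * sine_bump L m j x
    <= eps + 2 * x ^+ 2 / L.
Proof.
move=> L0 e0; have c1 := @cos1_gt0 R.
(* [a] is the constant of [sine_node_dist]; [e] solves [a * (e + e) = eps], and [m > e^-2] gives
   [(m e)^-1 <= e]. *)
pose a := 2 * L / cos 1; have a0 : 0 < a by rewrite divr_gt0// mulr_gt0.
pose e := eps / (2 * a); have e'0 : 0 < e by rewrite divr_gt0// mulr_gt0.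
pose m := (Num.truncn (e ^- 2)).+1.
have m0 : 0 < m%:R :> R by rewrite ltr0n.
have hm : (m%:R * e)^-1 <= e.
  rewrite invfM ler_pdivrMr// mulrC -expr2 -[leRHS]invrK.
  rewrite lef_pV2 ?posrE ?invr_gt0 ?exprn_gt0//.
  by rewrite ltW// truncnS_gt.
exists m => x; have [xL|xL] := leP `|x| L.
  apply: (@le_trans _ _ (\sum_(j < m.+1)
      a * (`|sine01 L x - j%:R / m%:R| * sine_bump L m j x))).
    apply: ler_sum => j _; rewrite mulrA ler_wpM2r ?sine_bump_ge0//.
    exact: sine_node_dist.
  rewrite -mulr_sumr (@le_trans _ _ (a * (e + (m%:R * e)^-1)))//.
    by rewrite ler_wpM2l ?(ltW a0)// sum_dist_bernstein// sine01_itv.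
  apply: (@le_trans _ _ (a * (e + e))); first by rewrite ler_wpM2l ?lerD2l// ltW.
  rewrite (_ : a * (e + e) = eps); last by rewrite /e; field; rewrite gt_eqF.
  by rewrite lerDl divr_ge0 ?(ltW L0)// mulr_ge0// sqr_ge0.
apply: (@le_trans _ _ (\sum_(j < m.+1) (2 * x ^+ 2 / L) * sine_bump L m j x)).
  apply: ler_sum => j _; rewrite ler_wpM2r ?sine_bump_ge0//.
  rewrite (le_trans (ler_normB _ _))//.
  have := sine_node_le m j (ltW L0); set y := `|sine_node _ _ _| => yL.
  rewrite ler_pdivlMr// -real_normK ?num_real//.
  by have := normr_ge0 (sine_node L m j); rewrite -/y; nra.
by rewrite -mulr_sumr sum_sine_bump mulr1 lerDr ltW.
Qed.

End sine_nodes.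

(** * Fluctuations of empirical means *)

Section empirical_mean.
Context d (T : measurableType d) {R : realType} (P : probability T R).
Context (n : nat) (Y : 'I_n -> {RV P >-> R}).
Implicit Types (g h : R -> R) (a : R).

Definition emp_integrable h :=
  forall i, P.-integrable setT (fun w => (h (Y i w))%:E).

Definition emp_mean h (w : T) : R := n%:R^-1 * \sum_(i < n) h (Y i w).

(** Both integrals are real-valued, an infinite value being read as 0; hence integrability
    accompanies the bounds on [emp_dev]. *)
Definition emp_dev h : R :=
  \int[P]_w `|emp_mean h w - \int[P]_w' emp_mean h w'|.

Lemma emp_integrableD g h : emp_integrable g -> emp_integrable h ->
  emp_integrable (fun x => g x + h x).
Proof.
by move=> ig ih i; under eq_fun do rewrite EFinD; apply: integrableD.
Qed.

Lemma emp_integrableZ a h : emp_integrable h ->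
  emp_integrable (fun x => a * h x).
Proof.
by move=> ih i; under eq_fun do rewrite EFinM; apply: integrableZl.
Qed.

Lemma emp_integrable_cst a : emp_integrable (fun=> a).
Proof. by move=> i; exact: finite_measure_integrable_cst. Qed.

Lemma emp_integrable_le g h : measurable_fun setT g ->
  (forall x, `|g x| <= h x) -> emp_integrable h -> emp_integrable g.
Proof.
move=> mg gh ih i; apply: le_integrable (ih i) => //.
  by apply/measurable_EFinP; exact: (measurableT_comp mg).
by move=> w _; rewrite lee_fin (le_trans (gh _))// ler_norm.
Qed.

Lemma emp_integrable_norm h : emp_integrable h ->
  emp_integrable (fun x => `|h x|).
Proof. by move=> ih i; exact: (integrable_norm (ih i)). Qed.

Lemma integrable_emp_mean h : emp_integrable h ->
  P.-integrable setT (EFin \o emp_mean h).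
Proof.
move=> ih; rewrite /emp_mean /comp; under eq_fun do rewrite EFinM -sumEFin.
apply: integrableZl => //; apply: integrable_sum => // i _.
Qed.

Lemma emp_meanD g h w :
  emp_mean (fun x => g x + h x) w = emp_mean g w + emp_mean h w.
Proof. by rewrite /emp_mean big_split/= mulrDr. Qed.

Lemma emp_meanZ a h w : emp_mean (fun x => a * h x) w = a * emp_mean h w.
Proof. by rewrite /emp_mean -mulr_sumr mulrCA. Qed.

Lemma emp_mean_le g h w : (forall x, g x <= h x) -> emp_mean g w <= emp_mean h w.
Proof.
by move=> gh; rewrite ler_wpM2l ?invr_ge0// ler_sum.
Qed.

Lemma emp_mean_norm h w : `|emp_mean h w| <= emp_mean (fun x => `|h x|) w.
Proof.
rewrite normrM ger0_norm ?invr_ge0// ler_wpM2l ?invr_ge0//.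
exact: ler_norm_sum.
Qed.

Lemma emp_mean_cst a w : (0 < n)%N -> emp_mean (fun=> a) w = a.
Proof.
move=> n0; rewrite /emp_mean sumr_const card_ord -(mulr_natl a) mulKf//.
by rewrite pnatr_eq0 -lt0n.
Qed.

Lemma integral_emp_meanD g h : emp_integrable g -> emp_integrable h ->
  \int[P]_w emp_mean (fun x => g x + h x) w =
  \int[P]_w emp_mean g w + \int[P]_w emp_mean h w.
Proof.
move=> ig ih; under eq_Rintegral do rewrite emp_meanD.
by rewrite RintegralD//; exact: integrable_emp_mean.
Qed.

Lemma integral_emp_meanZ a h : emp_integrable h ->
  \int[P]_w emp_mean (fun x => a * h x) w = a * \int[P]_w emp_mean h w.
Proof.
move=> ih; under eq_Rintegral do rewrite emp_meanZ.
by rewrite RintegralZl//; exact: integrable_emp_mean.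
Qed.

Lemma integral_emp_mean_le g h : emp_integrable g -> emp_integrable h ->
  (forall x, g x <= h x) ->
  \int[P]_w emp_mean g w <= \int[P]_w emp_mean h w.
Proof.
move=> ig ih gh; apply: le_Rintegral => //; try exact: integrable_emp_mean.
by move=> w _; exact: emp_mean_le.
Qed.

Lemma integrable_emp_dev h : emp_integrable h ->
  P.-integrable setT
    (fun w => `|emp_mean h w - \int[P]_w' emp_mean h w'|%:E).
Proof.
move=> ih; apply: (@integrable_norm _ _ _ _ _
  (fun w => emp_mean h w - \int[P]_w' emp_mean h w')).
rewrite /comp; under eq_fun do rewrite EFinB.
apply: integrableB => //; first exact: integrable_emp_mean.
exact: finite_measure_integrable_cst.
Qed.

Lemma emp_devD g h : emp_integrable g -> emp_integrable h ->
  emp_dev (fun x => g x + h x) <= emp_dev g + emp_dev h.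
Proof.
move=> ig ih; rewrite -RintegralD//; try exact: integrable_emp_dev.
apply: le_Rintegral => //; first exact/integrable_emp_dev/emp_integrableD.
  exact: (integrableD measurableT (integrable_emp_dev ig) (integrable_emp_dev ih)).
move=> w _; rewrite integral_emp_meanD// emp_meanD opprD addrACA.
exact: ler_normD.
Qed.

Lemma emp_devZ a h : emp_integrable h ->
  emp_dev (fun x => a * h x) = `|a| * emp_dev h.
Proof.
move=> ih; rewrite -RintegralZl//; last exact: integrable_emp_dev.
apply: eq_Rintegral => w _.
by rewrite integral_emp_meanZ// emp_meanZ -mulrBr normrM.
Qed.

(** Triangle inequality: the mean of [|emp_mean g|] and the absolute value of its expectation are
    each at most the expectation of [emp_mean h]. *)
Lemma emp_dev_le g h : measurable_fun setT g -> emp_integrable h ->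
  (forall x, `|g x| <= h x) -> emp_dev g <= 2 * \int[P]_w emp_mean h w.
Proof.
move=> mg ih gh; have ig := emp_integrable_le mg gh ih.
have h1 : \int[P]_w `|emp_mean g w| <= \int[P]_w emp_mean h w.
  apply: le_Rintegral => //; [|exact: integrable_emp_mean|].
    exact: (integrable_norm (integrable_emp_mean ig)).
  by move=> w _; apply: le_trans (emp_mean_norm _ _) _; exact: emp_mean_le.
apply: (@le_trans _ _ (\int[P]_w (`|emp_mean g w| + `|\int[P]_w' emp_mean g w'|))).
  apply: le_Rintegral => //; first exact: integrable_emp_dev.
    exact: (integrableD measurableT (integrable_norm (integrable_emp_mean ig))
      (finite_measure_integrable_cst P `|\int[P]_w emp_mean g w| measurableT)).
  by move=> w _; exact: ler_normB.
rewrite RintegralD//; last 2 first.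
  exact: (integrable_norm (integrable_emp_mean ig)).
  exact: finite_measure_integrable_cst.
rewrite Rintegral_cst//= probability_setT/= mulr1 mulr_natl mulr2n lerD//.
apply: le_trans h1; apply: le_normr_Rintegral => //.
exact: integrable_emp_mean.
Qed.

Lemma integral_emp_mean h : emp_integrable h ->
  \int[P]_w emp_mean h w = n%:R^-1 * \sum_(i < n) \int[P]_w h (Y i w).
Proof.
move=> ih; rewrite RintegralZl//; last first.
  by rewrite /comp; under eq_fun do rewrite -sumEFin; exact: integrable_sum.
congr (_ * _); rewrite /Rintegral.
under eq_integral do rewrite -sumEFin.
by rewrite integral_sum// sum_fine// => i _; exact: integrable_fin_num.
Qed.

Lemma integral_emp_mean_bound h a : 0 <= a -> emp_integrable h ->
  (forall i, \int[P]_w h (Y i w) <= a) -> \int[P]_w emp_mean h w <= a.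
Proof.
move=> a0 ih ha; rewrite integral_emp_mean//.
apply: (@le_trans _ _ (n%:R^-1 * \sum_(i < n) a)).
  by rewrite ler_wpM2l ?invr_ge0// ler_sum.
rewrite sumr_const card_ord -(mulr_natl a).
(* For [n = 0] the average is 0, and [0 <= a] concludes. *)
have [->|n0] := eqVneq n 0%N; first by rewrite mul0r mulr0.
by rewrite mulKf// pnatr_eq0.
Qed.

(* AM-GM in the form |z| <= eps + z^2 / eps *)
Lemma emp_dev_variance h (eps : R) : 0 < eps -> emp_integrable h ->
  ('V_P[emp_mean h] <= (eps ^+ 2)%:E)%E -> emp_dev h <= 2 * eps.
Proof.
move=> e0 ih; rewrite /variance covariance.unlock expectation.unlock => hV.
have ihm := measurable_int _ (integrable_emp_mean ih).
have mh : measurable_fun setT (emp_mean h) by exact/measurable_EFinP.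
set c := \int[P]_w emp_mean h w.
have mD : measurable_fun setT (fun w => emp_mean h w - c).
  by apply: measurable_funB.
rewrite -lee_fin /emp_dev -/c fineK; last first.
  by apply: integrable_fin_num => //; exact: integrable_emp_dev.
apply: (@le_trans _ _
    (\int[P]_w (eps%:E + (eps^-1)%:E * ((emp_mean h w - c) ^+ 2)%:E))%E).
  apply: ge0_le_integral => //.
  - by apply/measurable_EFinP; exact: measurableT_comp.
  - apply: emeasurable_funD => //; apply: measurable_funeM.
    by apply/measurable_EFinP; exact: measurable_funX.
  - move=> w _; rewrite -EFinM -EFinD lee_fin -(ler_pM2r e0) mulrDl mulrAC.
    rewrite mulVf ?gt_eqF// mul1r.
    rewrite -[X in _ <= _ + X]real_normK ?num_real//.
    set z := `|_|; have := sqr_ge0 (z - eps); have := sqr_ge0 z; nra.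
rewrite ge0_integralD//; last 3 first.
- by move=> w _; rewrite lee_fin ltW.
- by move=> w _; rewrite mule_ge0// lee_fin ?sqr_ge0// invr_ge0 ltW.
- by apply: measurable_funeM; apply/measurable_EFinP; exact: measurable_funX.
rewrite integral_cst//= probability_setT mule1 ge0_integralZl//; last 3 first.
- by apply/measurable_EFinP; exact: measurable_funX.
- by move=> w _; rewrite lee_fin sqr_ge0.
- by rewrite lee_fin invr_ge0 ltW.
rewrite mulr_natl mulr2n EFinD leeD2l//.
apply: (@le_trans _ _ ((eps^-1)%:E * (eps ^+ 2)%:E)%E).
  by rewrite lee_wpmul2l ?lee_fin ?invr_ge0 ?(ltW e0).
by rewrite -EFinM lee_fin expr2 mulKf// gt_eqF.
Qed.

End empirical_mean.

(** * Integration against the empirical and mean measures *)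

Section empirical_integrals.
Context {R : realType}.

Lemma ge0_integral_empirical (n : nat) (y : 'I_n -> R) (f : R -> \bar R) :
  measurable_fun setT f -> (forall x, (0 <= f x)%E) ->
  (\int[empirical y]_x f x = (n%:R^-1)%:E * \sum_(i < n) f (y i))%E.
Proof.
move=> mf f0.
have n0 : (0 <= n%:R^-1 :> R) by rewrite invr_ge0.
(* [msum] takes a sequence indexed by the natural numbers, so the Dirac masses are extended by the
   zero measure from index [n] on. *)
pose m_ k : {measure set R -> \bar R} :=
  if insub k is Some i then (\d_(y i) : {measure set R -> \bar R}) else mzero.
rewrite (eq_measure_integral (mscale (NngNum n0) (msum m_ n))); last first.
  move=> A mA _ /=; rewrite /empirical/= /mscale/= /msum/=; congr (_ * _)%E.
  by apply: eq_bigr => i _; rewrite /m_ valK.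
rewrite ge0_integral_mscale//= ge0_integral_measure_sum//; congr (_ * _)%E.
apply: eq_bigr => i _; rewrite /m_ valK integral_dirac//.
by rewrite diracT mul1e.
Qed.

Lemma integral_empirical (n : nat) (y : 'I_n -> R) (f : R -> R) :
  measurable_fun setT f ->
  (\int[empirical y]_x (f x)%:E = (n%:R^-1 * \sum_(i < n) f (y i))%:E)%E.
Proof.
move=> mf; rewrite integralE funerpos funerneg.
rewrite !ge0_integral_empirical.
- rewrite !sumEFin -!EFinM -EFinB -mulrBr -sumrB; congr (_ * _)%:E.
  by apply: eq_bigr => i _; rewrite -[in RHS](funrposBneg f).
- by apply/measurable_EFinP; exact: measurable_funrneg.
- by move=> x; rewrite lee_fin funrneg_ge0.
- by apply/measurable_EFinP; exact: measurable_funrpos.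
- by move=> x; rewrite lee_fin funrpos_ge0.
Qed.

Context d (T : measurableType d) (P : probability T R).
Context (n : nat) (Y : 'I_n -> {RV P >-> R}).

(** The mean measure is the average of the laws of the [Y i], by exchanging expectation and finite
    sum on each set. *)
Lemma ge0_integral_mean_empirical (f : R -> \bar R) :
  measurable_fun setT f -> (forall x, (0 <= f x)%E) ->
  (\int[mean_empirical Y]_x f x =
   (n%:R^-1)%:E * \sum_(i < n) \int[P]_w f (Y i w))%E.
Proof.
move=> mf f0.
have n0 : (0 <= n%:R^-1 :> R) by rewrite invr_ge0.
pose m_ k : {measure set R -> \bar R} :=
  if insub k is Some i then (distribution P (Y i) : {measure set R -> \bar R})
  else mzero.
rewrite (eq_measure_integral (mscale (NngNum n0) (msum m_ n))); last first.
  move=> A mA _ /=; rewrite /mean_empirical/= /mscale/= /msum/=.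
  rewrite /empirical_RV/= /empirical.
  rewrite ge0_integralZl//; last 2 first.
  - apply: emeasurable_sum => i.
    apply/measurable_EFinP; exact: (measurableT_comp (measurable_indic mA)).
  - by move=> w _; apply: sume_ge0.
  congr (_ * _)%E; rewrite ge0_integral_sum//; last first.
    move=> i; apply/measurable_EFinP.
    exact: (measurableT_comp (measurable_indic mA)).
  apply: eq_bigr => i _; rewrite /m_ valK /=.
  transitivity (\int[P]_w (\1_(Y i @^-1` A) w)%:E)%E; first exact: eq_integral.
  by rewrite integral_indic ?setIT//; exact: measurable_funPTI.
rewrite ge0_integral_mscale//= ge0_integral_measure_sum//; congr (_ * _)%E.
by apply: eq_bigr => i _; rewrite /m_ valK ge0_integral_distribution.
Qed.

(** Integrability makes the integrals of the positive and negative parts finite, so the two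
    nonnegative cases can be subtracted. *)
Lemma integral_mean_empirical (f : R -> R) :
  measurable_fun setT f -> emp_integrable Y f ->
  (\int[mean_empirical Y]_x (f x)%:E = (\int[P]_w emp_mean Y f w)%:E)%E.
Proof.
move=> mf intf; rewrite integralE funerpos funerneg.
have ip : emp_integrable Y f^\+.
  by move=> i; exact: (integrable_funrpos measurableT (intf i)).
have im : emp_integrable Y f^\-.
  by move=> i; exact: (integrable_funrneg measurableT (intf i)).
have H (g : R -> R) : measurable_fun setT g -> (forall x, 0 <= g x) ->
    emp_integrable Y g ->
    (\int[mean_empirical Y]_x (g x)%:E = (\int[P]_w emp_mean Y g w)%:E)%E.
  move=> mg g0 ig; rewrite ge0_integral_mean_empirical//.
  - rewrite integral_emp_mean// EFinM -sumEFin; congr (_ * _)%E.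
    by apply: eq_bigr => i _; rewrite fineK//; exact: integrable_fin_num.
  - exact/measurable_EFinP.
rewrite !H//; [|exact: measurable_funrneg|exact: measurable_funrpos].
rewrite -EFinB; congr EFin; rewrite -RintegralB//; [|exact: integrable_emp_mean..].
apply: eq_Rintegral => w _; rewrite -mulrBr -sumrB; congr (_ * _).
by apply: eq_bigr => i _; rewrite -[in RHS](funrposBneg f).
Qed.

End empirical_integrals.

(* No measurability of [f]: its integral is a supremum over simple functions
   below [f]. *)
Lemma ge0_le_integralT d (T : measurableType d) (R : realType)
    (mu : {measure set T -> \bar R}) (f g : T -> \bar R) :
  (forall x, (0 <= f x)%E) -> (forall x, (f x <= g x)%E) ->
  (\int[mu]_x f x <= \int[mu]_x g x)%E.
Proof.
move=> f0 fg; rewrite !ge0_integralTE//; last first.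
  by move=> x; exact: le_trans (fg x).
by apply: le_ereal_sup => _ [h hf <-]; exists h => // x; exact: le_trans (fg x).
Qed.

Lemma expr_even_ge0 {R : realDomainType} (x : R) j : 0 <= x ^+ (2 * j).
Proof. by rewrite exprM exprn_ge0// sqr_ge0. Qed.

(** The summand of index [j] in [Psi] is at most the whole sum, so every admissible [K] gives
    [E X^(2j) <= j! K^(2j)]. *)
Lemma moment_le_Psi_norm {R : realType} d (T : measurableType d)
    (P : probability T R) (r zeta : R) (X : {RV P >-> R}) (j : nat) :
  0 < zeta -> (Psi_norm P r X <= zeta%:E)%E ->
  (0 < j <= Num.truncn (r / 2))%N ->
  (\int[P]_w (X w ^+ (2 * j))%:E <= (j`!%:R * (zeta + 1) ^+ (2 * j))%:E)%E.
Proof.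
move=> z0 hX /andP[j0 jr].
(* The infimum need not be attained; the slack of 1 provides an admissible [K < zeta + 1]. *)
have /ereal_inf_lt[_ [K [K0 hK] <-]] : (Psi_norm P r X < (zeta + 1)%:E)%E.
  by apply: le_lt_trans hX _; rewrite lte_fin ltrDl.
rewrite lte_fin => Kz; rewrite expectation.unlock in hK.
have f0 : 0 < j`!%:R :> R by rewrite ltr0n fact_gt0.
have mX : measurable_fun setT (fun w => (X w ^+ (2 * j))%:E).
  by apply/measurable_EFinP; exact/measurable_funX/measurable_funPT.
have X0 w : 0 <= X w ^+ (2 * j) by exact: expr_even_ge0.
have c0 : 0 < K ^+ (2 * j) * j`!%:R by rewrite mulr_gt0// exprn_gt0.
have : ((K ^+ (2 * j) * j`!%:R)^-1%:E * \int[P]_w (X w ^+ (2 * j))%:E <= 1)%E.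
  rewrite -ge0_integralZl//;
    [|by move=> w _; rewrite lee_fin|by rewrite lee_fin invr_ge0 ltW].
  apply: le_trans hK; apply: ge0_le_integralT => w.
    by rewrite -EFinM lee_fin mulr_ge0// invr_ge0 ltW.
  rewrite -EFinM lee_fin /Psi (bigD1_seq j)/= ?mem_index_iota ?iota_uniq ?j0 ?ltnS//.
  apply: (@le_trans _ _ ((`|X w| / K) ^+ (2 * j) / j`!%:R)).
    rewrite expr_div_n [`|_| ^+ _]exprM real_normK ?num_real// -exprM.
    by rewrite invfM mulrC mulrA.
  rewrite lerDl sumr_ge0// => i _.
  by rewrite divr_ge0// exprn_ge0// divr_ge0// ltW.
rewrite lee_pdivrMl// mule1 => /le_trans; apply; rewrite lee_fin mulrC.
by rewrite ler_wpM2l ?(ltW f0)// lerXn2r ?nnegrE ?(ltW K0) ?(ltW Kz)// addr_ge0 ?ltW.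
Qed.

(** * Functions whose empirical means concentrate *)

Section triangular_array.
Context {R : realType} (d : nat -> measure_display).
Context (T : forall n, measurableType (d n)) (P : forall n, probability (T n) R).
Context (Y : forall n, 'I_n -> {RV (P n) >-> R}).
Arguments Y n : clear implicits.
Implicit Types (g h : R -> R) (a b phi : R).

(** Integrability is only asked for large [n]: a fixed power of [Y n i] is known to be integrable
    only once enough moments are controlled. *)
Definition dev_vanishes h := forall eps : R, 0 < eps ->
  \forall n \near \oo, emp_integrable (Y n) h /\ emp_dev (Y n) h <= eps.

Lemma dev_vanishes_ext g h : g =1 h -> dev_vanishes g -> dev_vanishes h.
Proof. by move=> /funext ->. Qed.

Lemma dev_vanishesD g h : dev_vanishes g -> dev_vanishes h ->
  dev_vanishes (fun x => g x + h x).
Proof.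
move=> vg vh e e0; have e2 : 0 < e / 2 by rewrite divr_gt0.
apply: filterS2 (vg _ e2) (vh _ e2) => n [ig dg] [ih dh].
split; first exact: emp_integrableD.
by rewrite (splitr e); exact: le_trans (emp_devD ig ih) (lerD dg dh).
Qed.

Lemma dev_vanishesZ a h : dev_vanishes h -> dev_vanishes (fun x => a * h x).
Proof.
move=> vh e e0; have a1 : 0 < `|a| + 1 by rewrite ltr_wpDl.
apply: filterS (vh _ (divr_gt0 e0 a1)) => n [ih dh].
split; first exact: emp_integrableZ.
rewrite emp_devZ// (le_trans (ler_wpM2l (normr_ge0 a) dh))//.
by rewrite mulrCA ler_piMr ?(ltW e0)// ler_pdivrMr// mul1r lerDl.
Qed.

Lemma dev_vanishes_cst a : dev_vanishes (fun=> a).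
Proof.
move=> e e0; near=> n.
have n0 : (0 < n)%N by near: n; exact: nbhs_infty_gt.
split; first exact: emp_integrable_cst.
rewrite (_ : emp_dev _ _ = 0) ?ltW//.
have E : emp_mean (Y n) (fun=> a) = cst a.
  by apply/funext => w; rewrite emp_mean_cst.
rewrite /emp_dev E; under eq_Rintegral do
  rewrite Rintegral_cst//= probability_setT/= mulr1 subrr normr0.
by rewrite Rintegral_cst// mul0r.
Unshelve. all: by end_near. Qed.

(** Split [h] as [(h - p) + p] with half of the tolerance for each; [p] depends on the tolerance but
    not on [n]. *)
Lemma dev_vanishes_approx h :
  (forall eps : R, 0 < eps -> exists2 p, dev_vanishes p &
    \forall n \near \oo, emp_integrable (Y n) h /\
      emp_dev (Y n) (fun x => h x - p x) <= eps) ->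
  dev_vanishes h.
Proof.
move=> approx e e0.
have e2 : 0 < e / 2 by rewrite divr_gt0.
have [p vp hp] := approx _ e2.
apply: filterS2 hp (vp _ e2) => n [ih dhp] [ip dp].
split => //; have -> : h = (fun x => (h x - p x) + p x).
  by apply/funext => x; rewrite subrK.
have ihp : emp_integrable (Y n) (fun x => h x - p x).
  rewrite (_ : (fun x => _) = (fun x => h x + (-1) * p x)); last first.
    by apply/funext => x; rewrite mulN1r.
  by apply: emp_integrableD => //; exact: emp_integrableZ.
by rewrite (splitr e); exact: le_trans (emp_devD ihp ip) (lerD dhp dp).
Qed.

(** * Concentration from controlled even moments and vanishing variances *)

Context (K : R) (J : nat -> nat).
Hypothesis J_infty : forall j, \forall n \near \oo, (j <= J n)%N.
Hypothesis even_moment : forall n i j, (0 < j <= J n)%N ->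
  (\int[P n]_w (Y n i w ^+ (2 * j))%:E <= (j`!%:R * K ^+ (2 * j))%:E)%E.
Hypothesis moment_variance : forall k, (0 < k)%N ->
  'V_(P n)[emp_mean (Y n) (fun x => x ^+ k)] @[n --> \oo] --> 0%E.

Lemma emp_integrable_even n j : (0 < j <= J n)%N ->
  emp_integrable (Y n) (fun x => x ^+ (2 * j)).
Proof.
move=> jJ i; apply/integrableP; split.
  by apply/measurable_EFinP; exact/measurable_funX/measurable_funPT.
under eq_integral do rewrite gee0_abs ?lee_fin ?expr_even_ge0//.
by apply: le_lt_trans (even_moment i jJ) _; rewrite ltry.
Qed.

Lemma integral_emp_mean_even n j : (0 < j <= J n)%N ->
  \int[P n]_w emp_mean (Y n) (fun x => x ^+ (2 * j)) w <= j`!%:R * K ^+ (2 * j).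
Proof.
move=> jJ; apply: integral_emp_mean_bound.
- by rewrite mulr_ge0// expr_even_ge0.
- exact: emp_integrable_even.
- move=> i; rewrite -lee_fin fineK; first exact: even_moment.
  by apply: integrable_fin_num => //; exact: (emp_integrable_even jJ i).
Qed.

(** Domination [|x|^k <= 1 + x^(2j)], by comparing [|x|] with 1. *)
Lemma emp_integrable_expr n k j : (0 < j <= J n)%N -> (k <= 2 * j)%N ->
  emp_integrable (Y n) (fun x => x ^+ k).
Proof.
move=> jJ kj; apply: (@emp_integrable_le _ _ _ _ _ _ _ (fun x => 1 + x ^+ (2 * j))).
- exact: measurable_funX.
- move=> x; rewrite normrX.
  have -> : x ^+ (2 * j) = `|x| ^+ (2 * j).
    by rewrite !exprM real_normK ?num_real.
  have [x1|x1] := leP `|x| 1.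
    by rewrite (le_trans (exprn_ile1 k (normr_ge0 x) x1))// lerDl exprn_ge0.
  by rewrite (le_trans (ler_weXn2l (ltW x1) kj))// lerDr.
- exact: emp_integrableD (emp_integrable_cst _ _) (emp_integrable_even jJ).
Qed.

Lemma dev_vanishes_expr k : dev_vanishes (fun x => x ^+ k).
Proof.
case: k => [|k]; first by apply: dev_vanishes_ext (dev_vanishes_cst 1).
move=> e e0; have e2 : 0 < (e / 2) ^+ 2 by rewrite exprn_gt0// divr_gt0.
(* The variance is extended-real: for large [n] it is finite, and then small. *)
have /fine_cvgP[Vfin /cvgr0Pnorm_le/(_ _ e2) Vle] := moment_variance (ltn0Sn k).
near=> n.
have kJ : (0 < k.+1 <= J n)%N by near: n; exact: J_infty.
have ik : emp_integrable (Y n) (fun x => x ^+ k.+1).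
  by apply: (emp_integrable_expr kJ); rewrite mul2n -addnn leq_addr.
split => //; rewrite (_ : e = 2 * (e / 2)); last by field.
apply: emp_dev_variance => //; first by rewrite divr_gt0.
have hf : 'V_(P n)[emp_mean (Y n) (fun x => x ^+ k.+1)] \is a fin_num by near: n.
rewrite -(fineK hf) lee_fin; apply: le_trans (ler_norm _) _.
by near: n.
Unshelve. all: by end_near. Qed.

Lemma dev_vanishes_poly (c : nat -> R) m :
  dev_vanishes (fun x => \sum_(j < m) c j * x ^+ j).
Proof.
elim: m => [|m ih].
  by apply: dev_vanishes_ext (dev_vanishes_cst 0) => x; rewrite big_ord0.
apply: dev_vanishes_ext (dev_vanishesD ih (dev_vanishesZ (c m) (dev_vanishes_expr m))).
by move=> x; rewrite big_ord_recr.
Qed.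

Lemma measurable_cos_affine a phi : measurable_fun setT (fun x => cos (a * x + phi)).
Proof.
apply: measurableT_comp; first exact: (continuous_measurable_fun (@continuous_cos R)).
by apply: measurable_funD => //; exact: measurable_funM.
Qed.

Lemma emp_integrable_cos n a phi : emp_integrable (Y n) (fun x => cos (a * x + phi)).
Proof.
apply: (@emp_integrable_le _ _ _ _ _ _ _ (fun=> 1)); last exact: emp_integrable_cst.
  exact: measurable_cos_affine.
by move=> x; exact: cos_max.
Qed.

(* The Taylor remainder of order 2j has mean at most (aK)^(2j) j! / (2j)!,
   hence at most (aK)^(2j) / j!. *)
Lemma dev_vanishes_cos a phi : dev_vanishes (fun x => cos (a * x + phi)).
Proof.
apply: dev_vanishes_approx => e e0; have e2 : 0 < e / 2 by rewrite divr_gt0.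
(* The order [j] is fixed before [n], since the terms of the exponential series of [(a K)^2] tend to
   0. *)
have /cvgr0Pnorm_le/(_ _ e2) := @cvg_exp_coeff R ((a * K) ^+ 2).
move=> /(filterI (nbhs_infty_gt 0)) /filter_ex[j [j0 hj]].
pose c i := cos (phi + i%:R * (pi / 2)) * (a ^+ i / i`!%:R).
exists (fun x => \sum_(i < 2 * j) c i * x ^+ i); first exact: dev_vanishes_poly.
near=> n; split; first exact: emp_integrable_cos.
have jJ : (0 < j <= J n)%N by rewrite j0/=; near: n; exact: J_infty.
have remainder x : `|cos (a * x + phi) - \sum_(i < 2 * j) c i * x ^+ i| <=
    a ^+ (2 * j) / (2 * j)`!%:R * x ^+ (2 * j).
  rewrite (eq_bigr (fun i : 'I_(2 * j) =>
      cos (phi + i%:R * (pi / 2)) * ((a * x) ^+ i / i`!%:R))); last first.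
    by move=> i _; rewrite /c exprMn; ring.
  have /le_trans := cos_taylor (2 * j) phi (a * x); apply.
  by rewrite [`|_| ^+ _]exprM real_normK ?num_real// -exprM exprMn mulrAC.
have ie := emp_integrableZ (a ^+ (2 * j) / (2 * j)`!%:R) (emp_integrable_even jJ).
apply: le_trans (emp_dev_le _ ie remainder) _.
  apply: measurable_funB; first exact: measurable_cos_affine.
  by apply: measurable_sum => i; apply: measurable_funM => //; exact: measurable_funX.
rewrite integral_emp_meanZ; last exact: emp_integrable_even.
rewrite mulrC -ler_pdivlMr//; apply: le_trans hj.
apply: (@le_trans _ _ (a ^+ (2 * j) / (2 * j)`!%:R * (j`!%:R * K ^+ (2 * j)))).
  by rewrite ler_wpM2l ?integral_emp_mean_even// divr_ge0// expr_even_ge0.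
apply: le_trans (ler_norm _); rewrite /exp_coeff/= -exprM exprMn.
have f0 m : 0 < m`!%:R :> R by rewrite ltr0n fact_gt0.
rewrite (_ : _ * (_ * _) =
  a ^+ (2 * j) * K ^+ (2 * j) * (j`!%:R / (2 * j)`!%:R)); last by ring.
rewrite ler_wpM2l ?mulr_ge0 ?expr_even_ge0// ler_pdivrMr// mulrC ler_pdivlMr//.
(* [(2j)!] is [j! j!] times a positive binomial coefficient. *)
rewrite -natrM ler_nat -(@bin_fact (2 * j) j) ?leq_pmull//.
by rewrite mul2n -addnn addnK leq_pmull// bin_gt0 leq_addr.
Unshelve. all: by end_near. Qed.

(* This strengthening of [dev_vanishes] is preserved by products with sines,
   by the product-to-sum formula. *)
Definition twisted_dev_vanishes h :=
  forall a phi, dev_vanishes (fun x => h x * cos (a * x + phi)).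

Lemma twisted_dev_vanishesD g h : twisted_dev_vanishes g ->
  twisted_dev_vanishes h -> twisted_dev_vanishes (fun x => g x + h x).
Proof.
move=> vg vh a phi; apply: dev_vanishes_ext (dev_vanishesD (vg a phi) (vh a phi)).
by move=> x; rewrite mulrDl.
Qed.

Lemma twisted_dev_vanishesZ b h : twisted_dev_vanishes h ->
  twisted_dev_vanishes (fun x => b * h x).
Proof.
move=> vh a phi; apply: dev_vanishes_ext (dev_vanishesZ b (vh a phi)).
by move=> x; rewrite mulrA.
Qed.

Lemma twisted_dev_vanishes_cst b : twisted_dev_vanishes (fun=> b).
Proof. by move=> a phi; exact/dev_vanishesZ/dev_vanishes_cos. Qed.

Lemma twisted_dev_vanishesM_sin b h : twisted_dev_vanishes h ->
  twisted_dev_vanishes (fun x => h x * sin (b * x)).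
Proof.
move=> vh a phi.
(* With [A = a x + phi] and [B = b x], the shifted cosines are [sin (A + B)] and [- sin (A - B)], of
   sum [2 cos A sin B]. *)
apply: dev_vanishes_ext (dev_vanishesZ 2^-1
  (dev_vanishesD (vh (a + b) (phi - pi / 2)) (vh (a - b) (phi + pi / 2)))).
move=> x.
have -> : (a + b) * x + (phi - pi / 2) = (a * x + phi + b * x) - pi / 2 by ring.
have -> : (a - b) * x + (phi + pi / 2) = (a * x + phi - b * x) + pi / 2 by ring.
by rewrite cosBpihalf cosDpihalf sinD sinB; field.
Qed.

(** The recursion of [bernstein] only adds and multiplies by [u = sine01 L x] and [1 - u], which are
    affine in [sin (x / L)]; the twisted class is stable under both. *)
Lemma twisted_dev_vanishes_bump L m j : twisted_dev_vanishes (sine_bump L m j).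
Proof.
have u_mul h : twisted_dev_vanishes h ->
    twisted_dev_vanishes (fun x => 2^-1 * (h x + h x * sin (L^-1 * x))).
  move=> vh; apply: twisted_dev_vanishesZ.
  exact: (twisted_dev_vanishesD vh (twisted_dev_vanishesM_sin _ vh)).
have v_mul h : twisted_dev_vanishes h ->
    twisted_dev_vanishes (fun x => 2^-1 * (h x + (-1) * (h x * sin (L^-1 * x)))).
  move=> vh; apply: twisted_dev_vanishesZ; apply: (twisted_dev_vanishesD vh).
  by apply: twisted_dev_vanishesZ; exact: (twisted_dev_vanishesM_sin _ vh).
elim: m j => [|m ih] [|j].
- exact: twisted_dev_vanishes_cst.
- exact: twisted_dev_vanishes_cst.
- rewrite (_ : sine_bump _ _ _ = (fun x => 2^-1 * (sine_bump L m 0 x +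
    (-1) * (sine_bump L m 0 x * sin (L^-1 * x))))); first exact: (v_mul _ (ih _)).
  by apply/funext => x; rewrite /sine_bump/= /sine01 (mulrC L^-1); field.
- rewrite (_ : sine_bump _ _ _ = (fun x => 2^-1 * (sine_bump L m j.+1 x +
    (-1) * (sine_bump L m j.+1 x * sin (L^-1 * x))) +
    2^-1 * (sine_bump L m j x + sine_bump L m j x * sin (L^-1 * x)))).
    exact: (twisted_dev_vanishesD (v_mul _ (ih _)) (u_mul _ (ih _))).
  by apply/funext => x; rewrite /sine_bump/= /sine01 (mulrC L^-1); field.
Qed.

Lemma dev_vanishes_bump L m j : dev_vanishes (sine_bump L m j).
Proof.
apply: dev_vanishes_ext (twisted_dev_vanishes_bump L m j 0 0) => x.
by rewrite mul0r addr0 cos0 mulr1.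
Qed.

End triangular_array.

(** * Comparison of the empirical and mean measures *)

Lemma measurable_sine_bump {R : realType} (L : R) m j :
  measurable_fun setT (sine_bump L m j).
Proof.
have mu : measurable_fun setT (sine01 L).
  apply: measurable_funM => //; apply: measurable_funD => //.
  apply: measurableT_comp; last exact: measurable_funM.
  exact: (continuous_measurable_fun (@continuous_sin R)).
have mu' : measurable_fun setT (fun x => 1 - sine01 L x) by exact: measurable_funB.
rewrite /sine_bump; elim: m j => [|m ih] [|j] /=.
- exact: measurable_cst.
- exact: measurable_cst.
- exact: measurable_funM mu' (ih 0).
- exact: measurable_funD (measurable_funM mu' (ih j.+1)) (measurable_funM mu (ih j)).
Qed.

Lemma lipschitz1_dist {R : realType} (f : R -> R) x y : 1.-lipschitz f ->
  `|f x - f y| <= `|x - y|.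
Proof. by move=> /(_ (x, y) (conj I I)) /=; rewrite mul1r. Qed.

Lemma lipschitz1_measurable {R : realType} (f : R -> R) : 1.-lipschitz f ->
  measurable_fun setT f.
Proof.
move=> lf; apply: continuous_measurable_fun => x.
apply/cvgrPdist_le => e e0; near=> y.
by apply: le_trans (lipschitz1_dist _ _ lf) _; near: y; exact: cvgr_dist_le.
Unshelve. all: by end_near. Qed.

Lemma wasserstein1_ge0 {R : realType} (mu nu : {measure set R -> \bar R}) :
  (0 <= wasserstein1 mu nu)%E.
Proof.
apply: le_trans (ereal_sup_ubound _); last first.
  exists (cst 0) => //= -[x y] _ /=; rewrite subrr normr0 mul1r//.
exact: abse_ge0.
Qed.

(** * Bounds on the Wasserstein distance by finitely many deviations *)

Section wasserstein_bound.
Context d (T : measurableType d) {R : realType} (P : probability T R).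
Context (n : nat) (Y : 'I_n -> {RV P >-> R}).
Hypothesis n_gt0 : (0 < n)%N.
Hypothesis sqr_int : emp_integrable Y (fun x => x ^+ 2).

Let centered h w := emp_mean Y h w - \int[P]_w' emp_mean Y h w'.

Lemma emp_integrable_sum m (a : nat -> R) (h : nat -> R -> R) :
  (forall j, emp_integrable Y (h j)) ->
  emp_integrable Y (fun x => \sum_(j < m) a j * h j x).
Proof.
move=> ih i; under eq_fun do rewrite -sumEFin.
by apply: integrable_sum => // j _; exact: (emp_integrableZ (a j) (ih j) i).
Qed.

(** Linearity separates the coefficients, which will carry the test function, from the deviations of
    fixed functions. *)
Lemma centered_sum m (a : nat -> R) (h : nat -> R -> R) w :
  (forall j, emp_integrable Y (h j)) ->
  centered (fun x => \sum_(j < m) a j * h j x) w =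
  \sum_(j < m) a j * centered (h j) w.
Proof.
move=> ih; elim: m => [|m IH].
  rewrite big_ord0 /centered (_ : (fun x => _) = (fun=> 0)); last first.
    by apply/funext => x; rewrite big_ord0.
  rewrite emp_mean_cst//; under eq_Rintegral do rewrite emp_mean_cst//.
  by rewrite Rintegral_cst// mul0r subrr.
rewrite big_ord_recr/= -IH /centered.
rewrite (_ : (fun x => _) = (fun x => \sum_(j < m) a j * h j x + a m * h m x)).
  rewrite emp_meanD emp_meanZ integral_emp_meanD.
  - by rewrite integral_emp_meanZ//; ring.
  - exact: emp_integrable_sum.
  - exact: emp_integrableZ.
by apply/funext => x; rewrite big_ord_recr.
Qed.

(** Each member of a nonnegative partition of unity is at most 1; for [j > m] the function is 0. *)
Lemma emp_integrable_bump L m j : emp_integrable Y (sine_bump L m j).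
Proof.
apply: (@emp_integrable_le _ _ _ _ _ _ _ (fun=> 1)); last exact: emp_integrable_cst.
  exact: measurable_sine_bump.
move=> x; rewrite ger0_norm ?sine_bump_ge0//.
have [jm|mj] := ltnP j m.+1; last by rewrite /sine_bump bernstein_small.
rewrite -(sum_sine_bump L m x) (bigD1 (Ordinal jm))//= lerDl sumr_ge0// => i _.
exact: sine_bump_ge0.
Qed.

(** Domination [|f x| <= |f 0| + |x| <= |f 0| + 1 + x^2]. *)
Lemma emp_integrable_lipschitz1 (f : R -> R) : 1.-lipschitz f ->
  emp_integrable Y f.
Proof.
move=> lf; apply: (@emp_integrable_le _ _ _ _ _ _ _ (fun x => (`|f 0| + 1) + x ^+ 2)).
- exact: lipschitz1_measurable.
- move=> x; rewrite -lerBlDl.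
  have := lipschitz1_dist x 0 lf; rewrite subr0 => h.
  have := ler_normD (f x - f 0) (f 0); rewrite subrK => h2.
  rewrite -[x ^+ 2]real_normK ?num_real//.
  by have := sqr_ge0 (`|x| - 1); move: h h2; move: `|x| `|f x| => u v; nra.
- exact: (emp_integrableD (emp_integrable_cst Y _) sqr_int).
Qed.

(** The right-hand side is free of [f], so it survives the supremum. Each [f] is split as
    [f 0 + s + r], with [s] in the span of the bumps and [r] small up to a quadratic tail. *)
Lemma wasserstein1_empirical_le L m c w : 0 < L ->
  (forall x, \sum_(j < m.+1) `|x - sine_node L m j| * sine_bump L m j x
    <= c + 2 * x ^+ 2 / L) ->
  (wasserstein1 (empirical_RV Y w) (mean_empirical Y) <=
   (2 * c + 2 / L * (emp_mean Y (fun x => x ^+ 2) w +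
                     \int[P]_w' emp_mean Y (fun x => x ^+ 2) w') +
    L * \sum_(j < m.+1) `|centered (sine_bump L m j) w|)%:E)%E.
Proof.
move=> L0 hc; apply: ge_ereal_sup => _ [f lf <-].
have mf := lipschitz1_measurable lf; have intf := emp_integrable_lipschitz1 lf.
rewrite integral_mean_empirical// integral_empirical// -EFinB/= lee_fin.
rewrite -/(emp_mean Y f w) -/(centered f w).
(* Subtracting [f 0] gives [|a j| <= |x_j| <= L], a bound uniform in [f]. *)
pose a j := f (sine_node L m j) - f 0.
pose s x := \sum_(j < m.+1) a j * sine_bump L m j x.
pose r x := f x + ((- f 0) + (-1) * s x).
have ints : emp_integrable Y s.
  by apply: emp_integrable_sum => j; exact: emp_integrable_bump.
have ms : measurable_fun setT s.
  apply: measurable_sum => j; apply: measurable_funM => //.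
  exact: measurable_sine_bump.
have mr : measurable_fun setT r.
  apply: measurable_funD => //; apply: measurable_funD => //.
  exact: measurable_funM.
have rE x : r x = \sum_(j < m.+1) (f x - f (sine_node L m j)) * sine_bump L m j x.
  have fE : f x - f 0 = \sum_(j < m.+1) (f x - f 0) * sine_bump L m j x.
    by rewrite -mulr_sumr sum_sine_bump mulr1.
  rewrite /r mulN1r addrA fE /s -sumrB; apply: eq_bigr => j _.
  by rewrite /a; ring.
have r_le x : `|r x| <= c + 2 / L * x ^+ 2.
  rewrite rE (le_trans (ler_norm_sum _ _ _))// mulrAC (le_trans _ (hc x))//.
  apply: ler_sum => j _; rewrite normrM (ger0_norm (sine_bump_ge0 _ _ _ _)).
  by rewrite ler_wpM2r ?sine_bump_ge0// lipschitz1_dist.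
have intB : emp_integrable Y (fun x => c + 2 / L * x ^+ 2).
  exact: (emp_integrableD (emp_integrable_cst Y _) (emp_integrableZ _ sqr_int)).
have intr : emp_integrable Y r := emp_integrable_le mr r_le intB.
(* Centring removes the constant [f 0]. *)
have centeredE : centered f w = centered r w + centered s w.
  rewrite /centered /r emp_meanD emp_meanD emp_meanZ emp_mean_cst//.
  rewrite integral_emp_meanD//; last first.
    exact: (emp_integrableD (emp_integrable_cst Y _) (emp_integrableZ _ ints)).
  rewrite integral_emp_meanD//; last 2 first.
    exact: emp_integrable_cst.
    exact: emp_integrableZ.
  rewrite integral_emp_meanZ//.
  under [X in _ - (_ + (X + _))]eq_Rintegral do rewrite emp_mean_cst//.
  by rewrite Rintegral_cst//= probability_setT/= mulr1; ring.
(* Here nothing cancels: the empirical mean of [r] and its expectation are bounded separately. *)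
have centered_r : `|centered r w| <=
    2 * c + 2 / L * (emp_mean Y (fun x => x ^+ 2) w +
                     \int[P]_w' emp_mean Y (fun x => x ^+ 2) w').
  have e1 : `|emp_mean Y r w| <= c + 2 / L * emp_mean Y (fun x => x ^+ 2) w.
    rewrite (le_trans (emp_mean_norm _ _ _))// (le_trans (emp_mean_le _ _ r_le))//.
    by rewrite emp_meanD emp_meanZ emp_mean_cst.
  have e2 : `|\int[P]_w' emp_mean Y r w'| <=
      c + 2 / L * \int[P]_w' emp_mean Y (fun x => x ^+ 2) w'.
    have iN := integral_emp_mean_le (emp_integrable_norm intr) intB r_le.
    rewrite (le_trans (le_normr_Rintegral _ (integrable_emp_mean intr)))//.
    apply: (le_trans _ (le_trans iN _)).
      apply: le_Rintegral => //.
      - exact: (integrable_norm (integrable_emp_mean intr)).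
      - exact: integrable_emp_mean (emp_integrable_norm intr).
      - by move=> w' _; exact: emp_mean_norm.
    rewrite integral_emp_meanD; last 2 first.
      exact: emp_integrable_cst.
      exact: (emp_integrableZ _ sqr_int).
    rewrite integral_emp_meanZ//.
    under [X in X + _ <= _]eq_Rintegral do rewrite emp_mean_cst//.
    by rewrite Rintegral_cst//= probability_setT/= mulr1.
  rewrite (le_trans (ler_normB _ _))// (le_trans (lerD e1 e2))//.
  by lra.
rewrite centeredE (le_trans (ler_normD _ _))// lerD//.
rewrite centered_sum; last by move=> j; exact: emp_integrable_bump.
rewrite (le_trans (ler_norm_sum _ _ _))// mulr_sumr; apply: ler_sum => j _.
rewrite normrM ler_wpM2r// /a (le_trans (lipschitz1_dist _ _ lf))// subr0.
by rewrite sine_node_le// ltW.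
Qed.

Lemma expected_wasserstein1_le L m c : 0 < L ->
  (forall x, \sum_(j < m.+1) `|x - sine_node L m j| * sine_bump L m j x
    <= c + 2 * x ^+ 2 / L) ->
  (\int[P]_w wasserstein1 (empirical_RV Y w) (mean_empirical Y) <=
   (2 * c + 4 / L * \int[P]_w emp_mean Y (fun x => x ^+ 2) w +
    L * \sum_(j < m.+1) emp_dev Y (sine_bump L m j))%:E)%E.
Proof.
move=> L0 hc; set q := emp_mean Y (fun x => x ^+ 2); set Q := \int[P]_w q w.
(* Monotonicity for nonnegative functions applies directly to the uncountable supremum; its majorant
   is integrable. *)
apply: le_trans.
  apply: ge0_le_integralT => w; first exact: wasserstein1_ge0.
  exact: (wasserstein1_empirical_le w L0 hc).
rewrite -/q -/Q.
have iq : P.-integrable setT (EFin \o q) := integrable_emp_mean sqr_int.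
have icst (a : R) : P.-integrable setT (EFin \o cst a) :=
  finite_measure_integrable_cst P a measurableT.
have iq1 : P.-integrable setT (EFin \o (fun w => q w + Q)).
  exact: (integrableD measurableT iq (icst Q)).
have iq2 : P.-integrable setT (EFin \o (fun w => 2 / L * (q w + Q))).
  exact: (integrableZl measurableT (2 / L) iq1).
have iq3 : P.-integrable setT (EFin \o (fun w => 2 * c + 2 / L * (q w + Q))).
  exact: (integrableD measurableT (icst (2 * c)) iq2).
pose D j w := `|centered (sine_bump L m j) w|.
have iD j : P.-integrable setT (EFin \o D j).
  exact: integrable_emp_dev (emp_integrable_bump L m j).
have iS : P.-integrable setT (EFin \o (fun w => \sum_(j < m.+1) D j w)).
  rewrite /comp; under eq_fun do rewrite -sumEFin.
  by apply: integrable_sum => // j _; exact: iD.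
have iLS : P.-integrable setT (EFin \o (fun w => L * \sum_(j < m.+1) D j w)).
  exact: (integrableZl measurableT L iS).
have iB : P.-integrable setT (EFin \o
    (fun w => 2 * c + 2 / L * (q w + Q) + L * \sum_(j < m.+1) D j w)).
  exact: (integrableD measurableT iq3 iLS).
rewrite -[leLHS]fineK; last exact: (integrable_fin_num measurableT iB).
rewrite lee_fin.
suff <- : \int[P]_w (2 * c + 2 / L * (q w + Q) + L * \sum_(j < m.+1) D j w) =
  2 * c + 4 / L * Q + L * \sum_(j < m.+1) emp_dev Y (sine_bump L m j) by [].
rewrite (RintegralD measurableT iq3 iLS) (RintegralD measurableT (icst _) iq2).
rewrite (RintegralZl (2 / L) measurableT iq1) (RintegralZl L measurableT iS).
rewrite (RintegralD measurableT iq (icst Q)).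
rewrite !Rintegral_cst//= !probability_setT/= !mulr1 -/Q.
(* The second moment and its expectation both integrate to [Q], whence the factor 4. *)
have -> : 2 / L * (Q + Q) = 4 / L * Q by field; rewrite gt_eqF.
congr (_ + _ * _).
rewrite /Rintegral; under eq_integral do rewrite -sumEFin.
rewrite integral_sum//; last by move=> j; exact: iD.
rewrite sum_fine// => j _; apply: (integrable_fin_num measurableT); exact: iD.
Qed.

End wasserstein_bound.

(** * Convergence of the expected distance *)

Theorem theorem3 (R : realType)
    (d : nat -> measure_display) (T : forall n, measurableType (d n))
    (P : forall n, probability (T n) R)
    (Y : forall n, 'I_n -> {RV (P n) >-> R})
    (r : nat -> R)
    (r_ge2 : forall n, (0 < n)%N -> 2 <= r n)
    (r_infty : r n @[n --> \oo] --> +oo)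
    (tail : exists2 zeta : R, 0 < zeta & forall n, (0 < n)%N ->
      (ereal_sup (range (fun i : 'I_n => Psi_norm (P n) (r n) (Y n i)))
        <= zeta%:E)%E)
    (moments : forall k, (1 <= k)%N ->
      'V_(P n)[fun w => n%:R^-1 * \sum_(i < n) Y n i w ^+ k]
        @[n --> \oo] --> 0%E) :
  (\int[P n]_w wasserstein1 (empirical_RV (Y n) w) (mean_empirical (Y n)))%E
    @[n --> \oo] --> 0%E.
Proof.
have [zeta zeta0 tailz] := tail.
(* The number of terms of [Psi], hence of even moments controlled in row [n]; [K] includes the slack
   of [moment_le_Psi_norm]. *)
pose J n := Num.truncn (r n / 2).
pose K := zeta + 1; have K0 : 0 < K by rewrite addr_gt0.
have J_gt0 n : (0 < n)%N -> (0 < J n)%N.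
  by move=> n0; rewrite truncn_gt0 ler_pdivlMr// mul1r r_ge2.
have J_infty j : \forall n \near \oo, (j <= J n)%N.
  have /cvgryPge/(_ (2 * j%:R)) := r_infty; apply: filterS => n rn.
  have r0 : 0 <= r n / 2 by rewrite divr_ge0// (le_trans _ rn)// mulr_ge0.
  by rewrite truncn_ge_nat// ler_pdivlMr// mulrC.
have even_moment n i j : (0 < j <= J n)%N ->
    (\int[P n]_w (Y n i w ^+ (2 * j))%:E <= (j`!%:R * K ^+ (2 * j))%:E)%E.
  apply: moment_le_Psi_norm => //.
  (* An index [i] in ['I_n] witnesses [n > 0], which the tail bound asks for. *)
  apply: le_trans (tailz n (leq_ltn_trans (leq0n i) (ltn_ord i))).
  by apply: ereal_sup_ubound; exists i.
have bump_vanishes := dev_vanishes_bump J_infty even_moment moments.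
have nonneg n : (0 <= \int[P n]_w
    wasserstein1 (empirical_RV (Y n) w) (mean_empirical (Y n)))%E.
  by apply: integral_ge0 => w _; exact: wasserstein1_ge0.
suff small (e : R) : 0 < e -> \forall n \near \oo,
    (\int[P n]_w wasserstein1 (empirical_RV (Y n) w) (mean_empirical (Y n))
      <= e%:E)%E.
  apply/fine_cvgP; split.
    apply: filterS (small 1 ltr01) => n; rewrite ge0_fin_numE//.
    by move=> /le_lt_trans; apply; rewrite ltry.
  apply/cvgr0Pnorm_le => e e0; apply: filterS (small e e0) => n W.
  rewrite /= ger0_norm ?fine_ge0// -lee_fin fineK// ge0_fin_numE//.
  by apply: le_lt_trans W _; rewrite ltry.
move=> e0.
(* [L] solves [4 K^2 / L = e / 4]; the tolerance [e / 8] given to the bumps enters twice; [eta]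
   makes [L] times the [m + 1] deviations at most [e / 4]. All are chosen before [n], and the total
   is [3 e / 4]. *)
pose L := 16 * K ^+ 2 / e.
have L0 : 0 < L by rewrite divr_gt0// mulr_gt0// exprn_gt0.
have e8 : 0 < e / 8 by rewrite divr_gt0.
have [m hm] := sine_bump_concentration L0 e8.
pose eta := e / (4 * L * m.+1%:R).
have eta0 : 0 < eta by rewrite divr_gt0// mulr_gt0// mulr_gt0.
(* There are finitely many bumps, so one threshold in [n] serves them all. *)
have devs : \forall n \near \oo, forall j : 'I_m.+1,
    emp_dev (Y n) (sine_bump L m j) <= eta.
  apply: filter_forall => j; have := bump_vanishes L m j _ eta0.
  by apply: filterS => n [].
apply: filterS2 devs (nbhs_infty_gt 0) => n dev_n n0.
have J1 : (0 < 1 <= J n)%N by rewrite J_gt0.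
have sqr_int : emp_integrable (Y n) (fun x => x ^+ 2).
  exact: (emp_integrable_even even_moment J1).
apply: le_trans (expected_wasserstein1_le n0 sqr_int L0 hm) _.
rewrite lee_fin.
have mean_sqr := integral_emp_mean_even even_moment J1.
rewrite factS fact0 !muln1 mul1r in mean_sqr.
have h1 : 4 / L * \int[P n]_w emp_mean (Y n) (fun x => x ^+ 2) w <= e / 4.
  apply: le_trans (ler_wpM2l _ mean_sqr) _; first by rewrite divr_ge0// ltW.
  suff -> : 4 / L * K ^+ 2 = e / 4 by [].
  by rewrite /L; field; rewrite !gt_eqF.
have h2 : L * \sum_(j < m.+1) emp_dev (Y n) (sine_bump L m j) <= e / 4.
  apply: (@le_trans _ _ (L * \sum_(j < m.+1) eta)).
    by rewrite ler_wpM2l ?(ltW L0)// ler_sum.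
  have -> : L * \sum_(j < m.+1) eta = e / 4; last by [].
  have : m.+1%:R != 0 :> R by rewrite pnatr_eq0.
  rewrite sumr_const card_ord -(mulr_natl eta) /eta; move: m.+1%:R => M M0.
  by field; rewrite M0 gt_eqF.
apply: le_trans (lerD (lerD (lexx _) h1) h2) _.
by lra.
Qed.
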